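(* Let $K$ be a finite simplicial complex and $L\subseteq K$ a subcomplex. If there is an NE-collapse from $K$ to $L$, then there is an NE-collapse of finite spaces from $\mathcal{X}(K)$ to $\mathcal{X}(L)$.
   Context: All simplicial complexes are finite (simplices are nonempty finite sets of vertices). For a vertex $v$ of a complex $K$, $\mathrm{lk}_K(v)$ is the subcomplex of simplices $\tau\in K$ with $v\notin\tau$ and $\tau\cup\{v\}\in K$, and $K\smallsetminus v$ is the full subcomplex of $K$ spanned by the vertices different from $v$. A complex $K$ is non-evasive if it has only one vertex or, inductively, if there is a vertex $v\in K$ such that both $K\smallsetminus v$ and $\mathrm{lk}_K(v)$ are non-evasive. If $v\in K$ is a vertex such that $\mathrm{lk}_K(v)$ is non-evasive, there is an elementary NE-collapse from $K$ to $K\smallsetminus v$; an NE-collapse from $K$ to a subcomplex $L$ is a finite (possibly empty) sequence of elementary NE-collapses from $K$ to $L$. Finite $T_0$-spaces are identified with finite posets: $x\le y$ if and only if $x\in U_y$, where $U_y$ is the minimal open set containing $y$ (so the open sets are the down-sets); subspaces correspond to subsets with the induced order. For $x$ in a finite $T_0$-space $X$, the link $\hat{C}_x$ is the subspace of points of $X$ comparable with $x$ and distinct from $x$. A finite $T_0$-space $X$ is non-evasive if it is a point or, inductively, if there exists $x\in X$ such that both $\hat{C}_x$ and $X\smallsetminus\{x\}$ are non-evasive. If $x\in X$ is such that $\hat{C}_x$ is non-evasive, there is an elementary NE-collapse from $X$ to $X\smallsetminus\{x\}$. There is an NE-collapse from $X$ to a subspace $Y$ if there is a finite (possibly empty) sequence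 of elementary NE-collapses from $X$ to $Y$. For a complex $K$, $\mathcal{X}(K)$ is the finite $T_0$-space corresponding to the poset of simplices of $K$ ordered by inclusion. *)

(* Defs.v *)
From HB Require Import structures.
From mathcomp Require Import all_boot all_order.
From Stdlib Require Import Relation_Operators.

Set Implicit Arguments.
Unset Strict Implicit.
Unset Printing Implicit Defensive.

Import Order.TTheory.

(* Simplices are nonempty sets.  A point of the ambient type T need not be a
   vertex of the complex, so every finite complex occurs for some T, as do its
   links and deletions, over the same T; the empty complex is allowed. *)
Definition is_complex (T : finType) (K : {set {set T}}) : bool :=
  (set0 \notin K) &&
  [forall s in K, forall t : {set T}, (t != set0) && (t \subset s) ==> (t \in K)].

Record complex (T : finType) : Type := Complex {
  simplices :> {set {set T}};
  simplicesP : is_complex simplices }.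

HB.instance Definition _ (T : finType) := [isSub for @simplices T].
HB.instance Definition _ (T : finType) := [Finite of complex T by <:].

Definition vertices (T : finType) (K : complex T) : {set T} :=
  [set v | [set v] \in simplices K].

Definition subcomplex (T : finType) (L K : complex T) : bool :=
  simplices L \subset simplices K.

Lemma is_complexP (T : finType) (K : {set {set T}}) :
  reflect (set0 \notin K /\
           forall s t : {set T}, s \in K -> t != set0 -> t \subset s -> t \in K)
          (is_complex K).
Proof.
apply: (iffP andP) => -[K0 HK]; split=> //.
  move=> s t sK t0 ts; move/forall_inP: HK => /(_ s sK)/forallP/(_ t).
  by rewrite t0 ts.
by apply/forall_inP => s sK; apply/forallP => t; apply/implyP=> /andP[]; apply: HK sK.
Qed.

Lemma link_subproof (T : finType) (K : complex T) (v : T) :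
  is_complex [set t in simplices K | (v \notin t) && (v |: t \in simplices K)].
Proof.
have /is_complexP[K0 HK] := simplicesP K.
apply/is_complexP; split=> [|s t]; first by rewrite inE (negPf K0).
rewrite !inE => /and3P[sK vs vsK] t0 ts.
rewrite (HK s t) //= (contra (subsetP ts v)) //=.
apply: HK vsK _ (setUS _ ts).
by apply/set0Pn; exists v; rewrite setU11.
Qed.

Definition link (T : finType) (K : complex T) (v : T) : complex T :=
  Complex (link_subproof K v).

Lemma del_subproof (T : finType) (K : complex T) (v : T) :
  is_complex [set t in simplices K | v \notin t].
Proof.
have /is_complexP[K0 HK] := simplicesP K.
apply/is_complexP; split=> [|s t]; first by rewrite inE (negPf K0).
rewrite !inE => /andP[sK vs] t0 ts.
by rewrite (HK s t) //= (contra (subsetP ts v)).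
Qed.

Definition del (T : finType) (K : complex T) (v : T) : complex T :=
  Complex (del_subproof K v).

Inductive nonevasive (T : finType) (K : complex T) : Prop :=
| nonevasive_vertex : #|vertices K| = 1 -> nonevasive K
| nonevasive_step (v : T) :
    v \in vertices K -> nonevasive (del K v) -> nonevasive (link K v) ->
    nonevasive K.

Definition NE_elementary (T : finType) (K L : complex T) : Prop :=
  exists v : T, [/\ v \in vertices K, nonevasive (link K v) & L = del K v].

Definition NE_collapse (T : finType) : complex T -> complex T -> Prop :=
  clos_refl_trans (complex T) (@NE_elementary T).

(* Finite T0-spaces are finite posets; the spaces below are the subspaces A of
   a finite poset X, with the induced order. *)
Definition space_link (d : Order.disp_t) (X : finPOrderType d) (A : {set X})
    (x : X) : {set X} :=
  [set y in A | (y != x) && (y >=< x)%O].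

Inductive space_nonevasive (d : Order.disp_t) (X : finPOrderType d)
    (A : {set X}) : Prop :=
| space_nonevasive_point : #|A| = 1 -> space_nonevasive A
| space_nonevasive_step (x : X) :
    x \in A -> space_nonevasive (space_link A x) -> space_nonevasive (A :\ x) ->
    space_nonevasive A.

Definition space_NE_elementary (d : Order.disp_t) (X : finPOrderType d)
    (A B : {set X}) : Prop :=
  exists x : X, [/\ x \in A, space_nonevasive (space_link A x) & B = A :\ x].

Definition space_NE_collapse (d : Order.disp_t) (X : finPOrderType d) :
    {set X} -> {set X} -> Prop :=
  clos_refl_trans {set X} (@space_NE_elementary d X).

Definition face_poset (T : finType) (K : complex T) : Type :=
  {s : {set T} | s \in simplices K}.

HB.instance Definition _ (T : finType) (K : complex T) :=
  SubFinite.on (face_poset K).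

Definition face_le (T : finType) (K : complex T) : rel (face_poset K) :=
  fun s t => val s \subset val t.

Lemma face_le_refl (T : finType) (K : complex T) : reflexive (@face_le T K).
Proof. by move=> s; apply: subxx. Qed.

Lemma face_le_anti (T : finType) (K : complex T) : antisymmetric (@face_le T K).
Proof. by move=> s t st; apply/val_inj/eqP; rewrite eqEsubset. Qed.

Lemma face_le_trans (T : finType) (K : complex T) : transitive (@face_le T K).
Proof. by move=> t s u; apply: subset_trans. Qed.

HB.instance Definition _ (T : finType) (K : complex T) :=
  Order.Le_isPOrder.Build Order.SetSubsetOrder.subset_display (face_poset K)
    (@face_le_refl T K) (@face_le_anti T K) (@face_le_trans T K).

(* For L a subcomplex of K: the poset of simplices of L, as a subspace of the
   poset of simplices of K. *)
Definition face_subspace (T : finType) (K L : complex T) : {set face_poset K} :=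
  [set s : face_poset K | val s \in simplices L].

Lemma face_leE (T : finType) (K : complex T) (s t : face_poset K) :
  (s <= t)%O = (val s \subset val t).
Proof. by []. Qed.

(* Main.v *)
(* Let v be a vertex of K whose link M is non-evasive.  In X(K) the points above
   {v} form a copy of X(M), and no points lie below {v}, so {v} can be removed as
   soon as X(M) is non-evasive.  Every remaining simplex s containing v has a
   greatest face avoiding v, namely s minus v; removing these s by increasing
   size, the link of s is at each stage a cone with apex s minus v.  Hence X(K)
   NE-collapses to X(K - v), and the same step, by induction, shows that X(M) is
   non-evasive whenever M is. *)
Require Import Defs.
From mathcomp Require Import all_boot all_order.
From Stdlib Require Import Relation_Operators.

Set Implicit Arguments.
Unset Strict Implicit.
Unset Printing Implicit Defensive.

Import Order.TTheory.

(** Cones with apex [c]: any other point [y] can be removed, because its link and the complement of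
    [y] are again cones with apex [c], with fewer points. The induction ends when only [c] is
    left. *)
Lemma space_nonevasive_cone (d : Order.disp_t) (X : finPOrderType d)
    (A : {set X}) (c : X) :
  c \in A -> {in A, forall y, (y >=< c)%O} -> space_nonevasive A.
Proof.
move: {2}#|A| (leqnn #|A|) => n; elim: n A => [|n IHn] A.
  by rewrite leqn0 cards_eq0 => /eqP->; rewrite inE.
move=> leAn cA cmpc; have [Ac0|/set0Pn[y]] := eqVneq (A :\ c) set0.
  apply: space_nonevasive_point.
  by rewrite (cardsD1 c) cA Ac0 cards0.
rewrite !inE => /andP[yc yA].
have ltA (B : {set X}) : B \subset A :\ y -> #|B| <= n.
  move=> /subset_leq_card/leq_trans; apply.
  by rewrite -ltnS (leq_trans _ leAn) // [#|A|](cardsD1 y) yA.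
apply: (space_nonevasive_step yA).
  apply: IHn; last by move=> z; rewrite inE => /andP[/cmpc].
    by apply: ltA; apply/subsetP=> z; rewrite !inE => /and3P[-> -> _].
  by rewrite inE cA eq_sym yc comparable_sym cmpc.
apply: IHn; first exact: ltA.
  by rewrite !inE eq_sym yc.
by move=> z; rewrite inE => /andP[_ /cmpc].
Qed.

(** Used to carry non-evasiveness from the faces of a link to the simplices above a vertex. Since
    [f] need only be an order embedding on [A], its values elsewhere may be arbitrary. *)
Lemma space_nonevasive_imset (d d' : Order.disp_t) (X : finPOrderType d)
    (Y : finPOrderType d') (f : X -> Y) (A : {set X}) :
  {in A &, {mono f : x y / (x <= y)%O}} ->
  space_nonevasive A -> space_nonevasive (f @: A).
Proof.
move=> fm neA; elim: neA fm => {A} [A A1|A x xA _ IHl _ IHd] fm.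
  have /eqP/cards1P[x ->] := A1.
  by apply: space_nonevasive_point; rewrite imset_set1 cards1.
have finj : {in A &, injective f}.
  by move=> y z yA zA fyz; apply/le_anti; rewrite -!fm // fyz lexx.
have sub (B : {set X}) : B \subset A -> {in B &, {mono f : x y / (x <= y)%O}}.
  by move=> /subsetP BA y z /BA yA /BA; apply: fm.
apply: (space_nonevasive_step (imset_f f xA)).
  suff -> : space_link (f @: A) (f x) = f @: space_link A x.
    by apply: IHl; apply: sub; apply/subsetP=> z; rewrite inE => /andP[].
  have fcmp y : y \in A ->
      (f y != f x) && (f y >=< f x)%O = (y != x) && (y >=< x)%O.
    by move=> yA; rewrite /Order.comparable !fm // (inj_in_eq finj).
  apply/setP=> z; rewrite inE; apply/andP/imsetP.
    case=> /imsetP[y yA ->]; rewrite fcmp // => yx.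
    by exists y; rewrite // inE yA.
  by case=> y; rewrite inE => /andP[yA yx] ->; rewrite imset_f ?fcmp.
suff -> : f @: A :\ f x = f @: (A :\ x) by apply: IHd; apply: sub; apply: subD1set.
apply/setP=> z; rewrite in_setD1; apply/andP/imsetP.
  case=> + /imsetP[y yA zE]; rewrite zE => fyx.
  by exists y; rewrite // in_setD1 yA andbT; apply: contraNneq fyx => ->.
case=> y; rewrite in_setD1 => /andP[yx yA] ->; split; last exact: imset_f.
by rewrite (inj_in_eq finj).
Qed.

Lemma space_nonevasive_collapse (d : Order.disp_t) (X : finPOrderType d)
    (A B : {set X}) :
  space_NE_collapse A B -> space_nonevasive B -> space_nonevasive A.
Proof.
elim=> {A B} [A _ [x [xA neA ->]]|//|A B C _ IHA _ IHB neC].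
  exact: space_nonevasive_step xA neA.
exact: IHA (IHB neC).
Qed.

(** Points outside [D] are removed from the bottom up. When [x] is removed, everything below it
    already lies in [D], so [c] is the greatest point below [x] and the link of [x] is a cone. As
    [D] stays fixed, the hypothesis survives each removal. *)
Lemma space_NE_collapse_greatest (d : Order.disp_t) (X : finPOrderType d)
    (A D : {set X}) :
    D \subset A ->
    {in A :\: D, forall x, exists c, [/\ c \in D, (c < x)%O &
      {in D, forall y, (y < x)%O -> (y <= c)%O}]} ->
  space_NE_collapse A D.
Proof.
move: {2}#|A| (leqnn #|A|) => n; elim: n A => [|n IHn] A leAn DA apex.
  move: leAn DA; rewrite leqn0 cards_eq0 => /eqP->.
  by rewrite subset0 => /eqP->; apply: rt_refl.
have [/set0Pn[x0 x0AD]|] := boolP (A :\: D != set0); last first.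
  rewrite negbK setD_eq0 => AD.
  suff -> : A = D by apply: rt_refl.
  by apply/eqP; rewrite eqEsubset AD.
(* Minimising this count yields a minimal element of [A :\: D]: a smaller [y] there would have
   strictly fewer points below it. *)
pose below x := #|[set y in A | (y < x)%O]|.
have [x xAD xmin] := arg_minnP below x0AD.
have [c [cD ltcx cmax]] := apex x xAD.
have /setDP[xA xD] := xAD; have cA := subsetP DA c cD.
have belowD y : y \in A -> (y < x)%O -> y \in D.
  move=> yA ltyx; apply: contraT => yD.
  have yAD : y \in A :\: D by rewrite inE yD.
  have := xmin y yAD; rewrite leqNgt => /negP[].
  apply/proper_card/properP; split.
    by apply/subsetP=> z; rewrite !inE => /andP[-> /lt_trans->].
  by exists y; rewrite !inE ?yA // ltxx.
apply: rt_trans (A :\ x) _ _ _.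
  apply: rt_step; exists x; split=> //.
  (* Points of the link below [x] are at most [c]; those above [x] are above [c]. *)
  apply: (@space_nonevasive_cone _ _ _ c) => [|y].
    by rewrite inE cA (lt_eqF ltcx) le_comparable // ltW.
  rewrite inE => /and3P[yA yx /orP[lexy|lexy]].
    have ltyx : (y < x)%O by rewrite lt_neqAle yx.
    by rewrite le_comparable // cmax ?belowD.
  by rewrite ge_comparable // (le_trans (ltW ltcx)).
apply: IHn.
- by move: leAn; rewrite [#|A|](cardsD1 x) xA.
- by rewrite subsetD1 DA.
- by move=> y; rewrite !inE => /and3P[yD _ yA]; apply: apex; rewrite inE yD.
Qed.

Section FaceSubspaces.

Variables (T : finType) (K : complex T).
Implicit Types (L : complex T) (v : T).

Lemma simplex_neq0 L s : s \in simplices L -> s != set0.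
Proof.
have /is_complexP[L0 _] := simplicesP L.
by move=> sL; apply: contraNneq L0 => <-.
Qed.

Lemma simplex_sub L s t :
  s \in simplices L -> t != set0 -> t \subset s -> t \in simplices L.
Proof. by have /is_complexP[_] := simplicesP L; apply. Qed.

Lemma subcomplex_del L v : subcomplex L K -> subcomplex (del L v) K.
Proof.
by move/subsetP=> LK; apply/subsetP=> s; rewrite inE => /andP[/LK].
Qed.

Lemma subcomplex_link L v : subcomplex L K -> subcomplex (link L v) K.
Proof.
by move/subsetP=> LK; apply/subsetP=> s; rewrite inE => /andP[/LK].
Qed.

Lemma face_subspace_vertex L :
  subcomplex L K -> #|vertices L| = 1 -> #|face_subspace K L| = 1.
Proof.
move=> /subsetP LK /eqP/cards1P[v Lv].
have vL : [set v] \in simplices L by move/setP/(_ v): Lv; rewrite !inE eqxx.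
apply/eqP/cards1P; exists (Sub [set v] (LK _ vL) : face_poset K).
apply/setP=> s; rewrite !inE -val_eqE /=; apply/idP/eqP=> [sL|->//].
apply/eqP; rewrite eqEsubset.
have sv : val s \subset [set v].
  apply/subsetP=> x xs; rewrite -Lv inE (simplex_sub sL) ?sub1set //.
  by apply/set0Pn; exists x; rewrite inE.
rewrite sv /= sub1set.
have /set0Pn[x xs] := simplex_neq0 sL.
by have := subsetP sv x xs; rewrite inE => /eqP <-.
Qed.

Lemma link_vertex_nonevasive L (w : face_poset K) v :
    subcomplex L K -> val w = [set v] ->
    space_nonevasive (face_subspace K (link L v)) ->
  space_nonevasive (space_link (face_subspace K L) w).
Proof.
move=> /subsetP LK wE.
(* The default [t] is never reached on faces of the link, where [v |: val t] is a simplex of [L],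
   hence of [K]. *)
pose f (t : face_poset K) : face_poset K := insubd t (v |: val t).
have fE (t : face_poset K) : t \in face_subspace K (link L v) -> val (f t) = v |: val t.
  by rewrite !inE => /and3P[_ _ /LK vtK]; rewrite val_insubd vtK.
suff -> : space_link (face_subspace K L) w = f @: face_subspace K (link L v).
  apply: space_nonevasive_imset => s t sM tM; rewrite !face_leE !fE //.
  (* Adjoining [v] reflects inclusion because [s] avoids [v]. *)
  move: sM; rewrite !inE => /and3P[_ vs _].
  by rewrite subUset sub1set setU11 -subDset setDE (setIidPl _) // subsetC sub1set inE.
apply/setP=> s; apply/idP/imsetP.
  rewrite !inE -val_eqE wE => /and3P[sL sv cmp].
  have vs : v \in val s.
    case/orP: cmp; rewrite face_leE wE ?sub1set // subset1 (negPf sv) /=.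
    by rewrite (negPf (simplex_neq0 sL)).
  have s0 : val s :\ v != set0.
    apply: contraNneq sv => s0; apply/eqP.
    by rewrite -(setD1K vs) s0 setU0.
  have tL : val s :\ v \in simplices L by rewrite (simplex_sub sL) ?subD1set.
  have tM : (Sub (val s :\ v) (LK _ tL) : face_poset K) \in face_subspace K (link L v).
    by rewrite !inE eqxx SubK tL setD1K.
  by exists (Sub (val s :\ v) (LK _ tL)) => //; apply: val_inj; rewrite fE ?SubK ?setD1K.
case=> t tM ->; move: (tM); rewrite !inE fE // => /and3P[tL vt vtL].
rewrite vtL -val_eqE fE // wE ge_comparable ?face_leE ?wE ?fE ?sub1set ?setU11 //.
rewrite andbT; apply: contraNneq (simplex_neq0 tL) => tv; rewrite -subset0.
apply/subsetP=> x xt; have : x \in v |: val t by rewrite setU1r.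
by rewrite tv inE => /eqP xv; rewrite -xv xt in vt.
Qed.

Lemma face_subspace_del_collapse L v :
    subcomplex L K -> v \in vertices L ->
    space_nonevasive (face_subspace K (link L v)) ->
  space_NE_collapse (face_subspace K L) (face_subspace K (del L v)).
Proof.
move=> LK; rewrite inE => vL neM.
have /subsetP LKs := LK.
pose w : face_poset K := Sub [set v] (LKs _ vL).
(* The point [w] goes first: deleting [v] from it leaves the empty set, which gives no apex, so its
   removal rests on the link hypothesis instead. *)
apply: rt_trans (face_subspace K L :\ w) _ _ _.
  by apply: rt_step; exists w; split; [rewrite inE | exact: link_vertex_nonevasive neM |].
apply: space_NE_collapse_greatest => [|s].
  apply/subsetP=> s; rewrite !inE => /andP[-> vs]; rewrite andbT.
  by apply: contraNneq vs => ->; rewrite /= set11.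
rewrite !inE negb_and negbK -val_eqE /= => /and3P[+ sv sL].
rewrite sL /= => vs.
have t0 : val s :\ v != set0.
  apply: contraNneq sv => s0; apply/eqP.
  by rewrite -(setD1K vs) s0 setU0.
have tL : val s :\ v \in simplices L by rewrite (simplex_sub sL) ?subD1set.
(* The greatest face of [s] avoiding [v]; it is proper since [v] lies in [s]. *)
exists (Sub (val s :\ v) (LKs _ tL)); split.
- by rewrite !inE eqxx tL.
- rewrite lt_neqAle face_leE -val_eqE !SubK subD1set andbT.
  by apply: contraTneq vs => <-; rewrite setD11.
- move=> y; rewrite !inE => /andP[_ vy] /ltW.
  by rewrite !face_leE SubK subsetD1 vy andbT.
Qed.

(** Keeping the ambient poset of [K] fixed while [L] varies lets the induction treat deletions and
    links as subspaces of one space. The link makes the collapse to the deletion possible, and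
    non-evasiveness is pulled back along it. *)
Lemma face_subspace_nonevasive L :
  subcomplex L K -> nonevasive L -> space_nonevasive (face_subspace K L).
Proof.
move=> + neL; elim: neL => {}L => [L1|v vL _ IHd _ IHl] LK.
  exact/space_nonevasive_point/face_subspace_vertex.
apply: space_nonevasive_collapse (IHd (subcomplex_del v LK)).
exact: (face_subspace_del_collapse LK vL (IHl (subcomplex_link v LK))).
Qed.

(** The inclusion of [M] in [K] is carried along so that successive collapses can be composed. *)
Lemma face_subspace_collapse L M :
    NE_collapse L M -> subcomplex L K ->
  space_NE_collapse (face_subspace K L) (face_subspace K M) /\ subcomplex M K.
Proof.
elim=> {L M} [L _ [v [vL neM ->]] LK|L LK|L M N _ IHL _ IHM LK].
- split; last exact: subcomplex_del.
  apply: (face_subspace_del_collapse LK vL).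
  exact: face_subspace_nonevasive (subcomplex_link v LK) neM.
- by split=> //; apply: rt_refl.
- have [LM MK] := IHL LK; have [MN NK] := IHM MK.
  by split=> //; apply: rt_trans LM MN.
Qed.

End FaceSubspaces.

Theorem corollary5p9 (T : finType) (K L : complex T) (hLK : subcomplex L K)
    (hKL : NE_collapse K L) :
  space_NE_collapse [set: face_poset K] (face_subspace K L).
Proof.
have [KL _] := face_subspace_collapse hKL (subxx (simplices K)).
suff -> : [set: face_poset K] = face_subspace K K by [].
by apply/setP=> s; rewrite !inE (valP s).
Qed.
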